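(* There exists a transcendental entire function $f$ which is log-regular and such that $Q_2(f)\neq A(f)$. Hence, for this $f$, $Q(f)=A(f)$ but $Q_2(f)\neq Q(f)$.
   Context: For a transcendental entire function $f$, $f^n$ denotes the $n$th iterate, and $M(r)=M(r,f)=\max_{|z|=r}|f(z)|$ for $r>0$; $M^n(r,f)$ denotes the $n$th iterate of the function $r\mapsto M(r,f)$. A transcendental entire function $f$ is log-regular if there exist $R_0>0$ and $k,d>1$ such that $M(r^k)\ge M(r)^{kd}$ for all $r>R_0$. Fast escaping set: $A(f)=\{z\in\mathbb{C}:\text{ there exists }\ell\in\mathbb{N}\text{ such that }|f^{n+\ell}(z)|\ge M^n(R,f)\text{ for all }n\in\mathbb{N}\}$, where $R>0$ is large enough that $M(r,f)>r$ for all $r\ge R$ (the set does not depend on the choice of such $R$). For $\varepsilon\in(0,1)$ let $\mu_{\varepsilon}(r)=M(r,f)^{\varepsilon}$ for $r>0$, and let $\mu_{2,\varepsilon}(r)=\exp((\log M(r,f))^{\varepsilon})$, defined for $r$ with $M(r,f)\ge 1$; superscripts $n$ denote $n$th iterates of these functions. The quite fast escaping set $Q(f)$ consists of all $z\in\mathbb{C}$ for which there exist $\varepsilon\in(0,1)$, $\ell\in\mathbb{N}$ and $R>0$ with $\mu_{\varepsilon}(r)>r$ for all $r\ge R$, such that $|f^{n+\ell}(z)|\ge\mu_{\varepsilon}^n(R)$ for all $n\in\mathbb{N}$. The set $Q_2(f)$ consists of all $z\in\mathbb{C}$ for which there exist $\varepsilon\in(0,1)$, $\ell\in\mathbb{N}$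 and $R>0$ with $\mu_{2,\varepsilon}(r)>r$ for all $r\ge R$, such that $|f^{n+\ell}(z)|\ge\mu_{2,\varepsilon}^n(R)$ for all $n\in\mathbb{N}$. (In both cases, for given $\varepsilon$ the choice of such $R$ does not affect the set.) *)

(* Defs.v *)
(* Stdlib reals with Coquelicot's complex numbers. *)
From Stdlib Require Import Reals.
From Coquelicot Require Import Coquelicot.

Local Open Scope R_scope.

Definition entire (f : C -> C) : Prop :=
  forall z : C, ex_derive (K := C_AbsRing) (V := C_NormedModule) f z.

Definition is_polynomial (f : C -> C) : Prop :=
  exists (n : nat) (a : nat -> C),
    forall z : C, f z = sum_n (fun k : nat => (a k * z ^ k)%C) n.

Definition transcendental_entire (f : C -> C) : Prop :=
  entire f /\ ~ is_polynomial f.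

(* M(r, f).  For continuous [f] and [r >= 0] the supremum is finite and
   attained, so it is the maximum of |f| on the circle |z| = r. *)
Definition max_modulus (f : C -> C) (r : R) : R :=
  real (Lub_Rbar (fun x : R => exists z : C, Cmod z = r /\ x = Cmod (f z))).

(* [rpow x y] is x^y for x >= 0 and y > 0.  [Rpower] alone is not suitable at
   x = 0, since [Rpower 0 y = 1]; the case x = log M(r) = 0 does occur. *)
Definition rpow (x y : R) : R :=
  if Rlt_dec 0 x then Rpower x y else 0.

Definition log_regular (f : C -> C) : Prop :=
  exists R0 k d : R, 0 < R0 /\ 1 < k /\ 1 < d /\
    forall r : R, R0 < r ->
      max_modulus f (rpow r k) >= rpow (max_modulus f r) (k * d).

Definition mu (f : C -> C) (eps r : R) : R :=
  rpow (max_modulus f r) eps.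

(* Meaningful only when [1 <= max_modulus f r]. *)
Definition mu2 (f : C -> C) (eps r : R) : R :=
  exp (rpow (ln (max_modulus f r)) eps).

(* [z] eventually escapes at least as fast as the iterates of [g] from [R1]. *)
Definition escapes_at_rate (f : C -> C) (g : R -> R) (R1 : R) (z : C) : Prop :=
  exists l : nat, forall n : nat,
    Cmod (Nat.iter (n + l) f z) >= Nat.iter n g R1.

(* A(f).  The set of [z] obtained from a single admissible [R1] does not depend
   on [R1], so quantifying [R1] existentially gives that same set. *)
Definition fast_escaping (f : C -> C) (z : C) : Prop :=
  exists R1 : R, 0 < R1 /\
    (forall r : R, R1 <= r -> max_modulus f r > r) /\
    escapes_at_rate f (max_modulus f) R1 z.

(* Q(f) *)
Definition quite_fast_escaping (f : C -> C) (z : C) : Prop :=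
  exists eps R1 : R, 0 < eps < 1 /\ 0 < R1 /\
    (forall r : R, R1 <= r -> mu f eps r > r) /\
    escapes_at_rate f (mu f eps) R1 z.

(* Q_2(f).  The condition [1 <= max_modulus f r] says that mu2 is defined at
   every r >= R1, hence along its iterates from R1. *)
Definition quite_fast_escaping2 (f : C -> C) (z : C) : Prop :=
  exists eps R1 : R, 0 < eps < 1 /\ 0 < R1 /\
    (forall r : R, R1 <= r -> 1 <= max_modulus f r /\ mu2 f eps r > r) /\
    escapes_at_rate f (mu2 f eps) R1 z.

Definition same_set (A B : C -> Prop) : Prop := forall z : C, A z <-> B z.

(* Main.v *)
Require Import Defs.
From Stdlib Require Import Reals Lra Lia ClassicalEpsilon.
From Coquelicot Require Import Coquelicot.

(** Take f(z) = sum_n z^n / 4^(n^2).  Its coefficients are positive, so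
    M(r) = f(r), and f(16 w) = 1 + 4 w f(w) gives
    (log r)^2 / 32 <= log M(r) <= (log r)^2 for r >= 16; this yields
    log-regularity and Q(f) = A(f).  The same equation shows that f(-16^m) has
    sign (-1)^m and modulus at least M(16^m) / 5, so f maps the real interval
    [-256 r, -r] over [-M(r) / 5, 0].  Hence some real orbit satisfies
    r_n <= |x_n| <= 256 r_n, where r_n are the iterates of mu_{2,3/4}.  Since
    log r_(n+1) <= (log r_n)^(3/2) while log M(r) grows like (log r)^2, this
    orbit is in Q_2(f) but not in A(f). *)

Local Open Scope R_scope.

(** * The real function *)

Definition theta_coef (n : nat) : R := / 4 ^ (n * n).

Definition theta : R -> R := PSeries theta_coef.

Lemma theta_coef_pos (n : nat) : 0 < theta_coef n.
Proof. apply Rinv_0_lt_compat, pow_lt; lra. Qed.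

Lemma theta_coef_S (n : nat) :
  theta_coef (S n) = / 4 * (/ 16) ^ n * theta_coef n.
Proof.
  unfold theta_coef.
  replace (S n * S n)%nat with (1 + 2 * n + n * n)%nat by ring.
  rewrite !pow_add, pow_mult, pow_inv.
  replace (4 ^ 2) with 16 by ring.
  field; split; apply pow_nonzero; lra.
Qed.

Lemma CV_radius_theta : CV_radius theta_coef = p_infty.
Proof.
  apply CV_radius_infinite_DAlembert.
  - intros n; apply Rgt_not_eq, theta_coef_pos.
  - apply is_lim_seq_ext with (fun n => / 4 * (/ 16) ^ n).
    + intros n; rewrite theta_coef_S.
      replace (/ 4 * (/ 16) ^ n * theta_coef n / theta_coef n)
        with (/ 4 * (/ 16) ^ n).
      * rewrite Rabs_pos_eq; [reflexivity |].
        assert (0 < (/ 16) ^ n) by (apply pow_lt; lra); lra.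
      * field; apply Rgt_not_eq, theta_coef_pos.
    + replace (Finite 0) with (Rbar_mult (/ 4) 0)
        by (simpl; f_equal; ring).
      apply is_lim_seq_scal_l, is_lim_seq_geom.
      rewrite Rabs_pos_eq; lra.
Qed.

Lemma ex_series_theta (x : R) : ex_series (fun n => theta_coef n * x ^ n).
Proof.
  apply ex_series_Rabs, CV_disk_inside.
  rewrite CV_radius_theta; exact I.
Qed.

Lemma ex_pseries_theta (x : R) : ex_pseries theta_coef x.
Proof. apply CV_radius_inside; rewrite CV_radius_theta; exact I. Qed.

Lemma theta_continuity : continuity theta.
Proof.
  intros x; apply PSeries_continuity.
  rewrite CV_radius_theta; exact I.
Qed.

(** Index shift: the coefficient at n + 1 times 16^(n+1) is 4 times the coefficient at n, so
    removing the constant term of the series at 16 x leaves 4 x times the series at x. *)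
Lemma theta_functional (x : R) : theta (16 * x) = 1 + 4 * x * theta x.
Proof.
  unfold theta; rewrite PSeries_decr_1 by apply ex_pseries_theta.
  replace (theta_coef 0) with 1 by (unfold theta_coef; simpl; lra).
  replace (PSeries (PS_decr_1 theta_coef) (16 * x))
    with (/ 4 * PSeries theta_coef x); [lra |].
  unfold PSeries; rewrite <- Series_scal_l.
  apply Series_ext; intros n; unfold PS_decr_1.
  rewrite theta_coef_S, Rpow_mult_distr, pow_inv.
  field; apply pow_nonzero; lra.
Qed.

Lemma theta_incr (x y : R) : 0 <= x <= y -> theta x <= theta y.
Proof.
  intros Hxy; apply Series_le; [| apply ex_series_theta].
  intros n; pose proof (theta_coef_pos n).
  assert (0 <= x ^ n) by (apply pow_le; lra).
  assert (x ^ n <= y ^ n) by (apply pow_incr; lra).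
  nra.
Qed.

Lemma Rabs_theta_le (x : R) : Rabs (theta x) <= theta (Rabs x).
Proof.
  assert (forall n, Rabs (theta_coef n * x ^ n) = theta_coef n * Rabs x ^ n)
    as Habs.
  { intros n; rewrite Rabs_mult, RPow_abs, (Rabs_pos_eq (theta_coef n));
      [reflexivity | apply Rlt_le, theta_coef_pos]. }
  unfold theta, PSeries at 2; rewrite <- (Series_ext _ _ Habs).
  apply Series_Rabs, (ex_series_ext _ _ (fun n => eq_sym (Habs n))).
  apply ex_series_theta.
Qed.

Lemma theta_ge_1 (x : R) : 0 <= x -> 1 <= theta x.
Proof.
  intros Hx; replace 1 with (theta 0); [apply theta_incr; lra |].
  unfold theta; rewrite PSeries_0; unfold theta_coef; simpl; lra.
Qed.

(** * Values at the points 16^m and -16^m *)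

Lemma pow16_sqr (m : nat) : 4 ^ (S m * S m) = 4 * 16 ^ m * 4 ^ (m * m).
Proof.
  replace (S m * S m)%nat with (1 + 2 * m + m * m)%nat by ring.
  rewrite !pow_add, pow_mult.
  replace (4 ^ 2) with 16 by ring; ring.
Qed.

(** Lets the summand 1 of the functional equation be absorbed by the correction terms 4^-m of the
    inductive bounds below. *)
Lemma pow4_sqr_ge (m : nat) : 1 <= 4 ^ (m * m) / 4 ^ m.
Proof.
  apply Rle_div_r; [apply pow_lt; lra |].
  rewrite Rmult_1_l; apply Rle_pow; [lra | nia].
Qed.

(** The functional equation at 1/16 reads theta(1) = 1 + theta(1/16) / 4 <= 1 + theta(1) / 4. The
    value 4/3 = 5/3 - 1/3 starts the induction that follows. *)
Lemma theta_1 : 1 <= theta 1 <= 4 / 3.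
Proof.
  split; [apply theta_ge_1; lra |].
  pose proof (theta_functional (/ 16)) as H.
  replace (16 * / 16) with 1 in H by field.
  assert (theta (/ 16) <= theta 1) by (apply theta_incr; lra).
  lra.
Qed.

(* The terms [4^-m] make both bounds on [theta (±16^m) / 4^(m^2)] inductive:
   the functional equation changes this quotient by exactly [4^-(m+1)^2] in
   modulus. *)
Lemma theta_pow16_bounds (m : nat) :
  4 ^ (m * m) <= theta (16 ^ m) <= (5 / 3 - / 3 / 4 ^ m) * 4 ^ (m * m).
Proof.
  induction m as [| m IH].
  - simpl; pose proof theta_1; lra.
  - change (16 ^ S m) with (16 * 16 ^ m).
    rewrite theta_functional.
    pose proof (pow4_sqr_ge (S m)) as Hs; revert Hs.
    rewrite pow16_sqr; change (4 ^ S m) with (4 * 4 ^ m).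
    assert (0 < 16 ^ m) as H16 by (apply pow_lt; lra).
    assert (0 < 4 ^ m) as H4 by (apply pow_lt; lra).
    set (u := 16 ^ m) in *; set (v := 4 ^ m) in *;
      set (w := 4 ^ (m * m)) in *.
    intros Hs; split; [nra |].
    replace ((5 / 3 - / 3 / (4 * v)) * (4 * u * w))
      with (4 * u * ((5 / 3 - / 3 / v) * w) + 4 * u * w / (4 * v))
      by (field; lra).
    nra.
Qed.

Lemma theta_neg_pow16 (m : nat) :
  (1 / 3 + / 3 / 4 ^ m) * 4 ^ (m * m) <= (-1) ^ m * theta (- 16 ^ m).
Proof.
  induction m as [| m IH].
  (* Here theta(-1) = 1 - theta(-1/16) / 4 and theta(-1/16) <= 4/3, which gives exactly the 2/3 =
     1/3 + 1/3 claimed for m = 0. *)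
  - simpl; pose proof (theta_functional (- / 16)) as H.
    replace (16 * - / 16) with (- (1)) in H by field.
    assert (theta (- / 16) <= theta 1) as Hle.
    { apply Rle_trans with (1 := Rle_abs _).
      apply Rle_trans with (1 := Rabs_theta_le _).
      rewrite Rabs_Ropp, Rabs_pos_eq by lra.
      apply theta_incr; lra. }
    pose proof theta_1; lra.
  - change (16 ^ S m) with (16 * 16 ^ m).
    replace (- (16 * 16 ^ m)) with (16 * - 16 ^ m) by ring.
    rewrite theta_functional.
    pose proof (pow4_sqr_ge (S m)) as Hs; revert Hs.
    rewrite pow16_sqr; change (4 ^ S m) with (4 * 4 ^ m).
    change ((-1) ^ S m) with (-1 * (-1) ^ m).
    assert (0 < 16 ^ m) as H16 by (apply pow_lt; lra).
    assert (0 < 4 ^ m) as H4 by (apply pow_lt; lra).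
    assert (-1 <= (-1) ^ m <= 1) as H1.
    { apply Rabs_le_between; rewrite pow_1_abs; lra. }
    set (u := 16 ^ m) in *; set (v := 4 ^ m) in *;
      set (w := 4 ^ (m * m)) in *; set (s := (-1) ^ m) in *.
    intros Hs.
    replace ((1 / 3 + / 3 / (4 * v)) * (4 * u * w))
      with (4 * u * ((1 / 3 + / 3 / v) * w) - 4 * u * w / (4 * v))
      by (field; lra).
    nra.
Qed.

Lemma theta_neg_large (m : nat) :
  theta (16 ^ m) <= 5 * ((-1) ^ m * theta (- 16 ^ m)).
Proof.
  pose proof (theta_pow16_bounds m); pose proof (theta_neg_pow16 m).
  assert (0 < / 3 / 4 ^ m)
    by (apply Rdiv_lt_0_compat; [lra | apply pow_lt; lra]).
  assert (0 < 4 ^ (m * m)) by (apply pow_lt; lra).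
  nra.
Qed.

(** * Growth of log M(r) *)

Lemma pow16_bracket (r : R) :
  16 <= r -> exists m : nat, (1 <= m)%nat /\ 16 ^ m <= r < 16 ^ S m.
Proof.
  intros Hr.
  destruct (nfloor_ex (ln r / ln 16)) as [m Hm].
  { apply Rdiv_le_0_compat; [| rewrite <- ln_1; apply ln_increasing; lra].
    rewrite <- ln_1; apply Rlt_le, ln_increasing; lra. }
  assert (0 < ln 16) as H16 by (rewrite <- ln_1; apply ln_increasing; lra).
  assert (ln 16 <= ln r) by (apply ln_le; lra).
  assert (INR m * ln 16 <= ln r < INR (S m) * ln 16) as [Hl Hu].
  { rewrite S_INR; split; [apply Rle_div_r | apply Rlt_div_l]; tauto. }
  rewrite <- ln_pow in Hl, Hu by lra.
  exists m; split; [| split].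
  - destruct m; [simpl in Hu; rewrite Rmult_1_r in Hu; lra | lia].
  - apply Rnot_lt_le; intros Hlt; apply ln_increasing in Hlt; lra.
  - apply ln_lt_inv; [lra | apply pow_lt; lra | lra].
Qed.

Lemma ln_4_bounds : 9 / 8 <= ln 4 <= 2.
Proof.
  assert (ln 4 = 2 * ln 2) as ->
    by (replace 4 with (2 ^ 2) by ring; rewrite ln_pow; simpl; lra).
  split.
  (* This is e^9 <= 3^9 = 19683 <= 65536 = 2^16. *)
  - assert (9 <= INR 16 * ln 2) as H; [| simpl in H; lra].
    rewrite <- ln_pow by lra.
    replace 9 with (ln (exp 1 ^ 9))
      by (rewrite ln_pow, ln_exp by apply exp_pos; simpl; ring).
    apply ln_le; [apply pow_lt, exp_pos |].
    apply Rle_trans with (3 ^ 9); [| lra].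
    apply pow_incr; split; [apply Rlt_le, exp_pos | apply exp_le_3].
  - assert (ln 2 <= 1); [| lra].
    rewrite <- (ln_exp 1); apply ln_le; [lra |].
    pose proof (exp_ineq1_le 1); lra.
Qed.

(** Put c = log 4 and 16^m <= r < 16^(m+1). Then 2 m c <= log r <= 2 (m+1) c and m^2 c <= log
    theta(r) <= c/2 + (m+1)^2 c, where c/2 = log 2 covers the factor 5/3. The lower bound follows
    from m + 1 <= 2 m and c <= 2. The upper one needs m^2 + 2 m + 3/2 <= 4 m^2 c, which c >= 9/8
    provides, with no slack left at m = 1 when c is replaced by 9/8. *)
Lemma ln_theta_bounds (r : R) :
  16 <= r -> (ln r)² / 32 <= ln (theta r) <= (ln r)².
Proof.
  intros Hr; destruct (pow16_bracket r Hr) as [m [Hm [Hl Hu]]].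
  assert (0 < 16 ^ m) as H16 by (apply pow_lt; lra).
  assert (INR m * (2 * ln 4) <= ln r <= INR (S m) * (2 * ln 4)) as Hy.
  { replace (2 * ln 4) with (ln 16)
      by (replace 16 with (4 ^ 2) by ring; rewrite ln_pow; simpl; lra).
    rewrite <- !ln_pow by lra.
    split; apply ln_le; lra. }
  assert (INR m * INR m * ln 4 <= ln (theta r)) as Hlo.
  { rewrite <- mult_INR, <- ln_pow by lra.
    apply ln_le; [apply pow_lt; lra |].
    apply Rle_trans with (theta (16 ^ m));
      [apply theta_pow16_bounds | apply theta_incr; lra]. }
  assert (ln (theta r) <= ln 4 / 2 + INR (S m) * INR (S m) * ln 4) as Hup.
  { replace (ln 4 / 2) with (ln 2)
      by (replace 4 with (2 ^ 2) by ring; rewrite ln_pow; simpl; lra).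
    rewrite <- mult_INR, <- ln_pow by lra.
    rewrite <- ln_mult by (try apply pow_lt; lra).
    apply ln_le; [pose proof (theta_ge_1 r ltac:(lra)); lra |].
    apply Rle_trans with (theta (16 ^ S m)); [apply theta_incr; lra |].
    apply Rle_trans with (1 := proj2 (theta_pow16_bounds (S m))).
    apply Rmult_le_compat_r; [apply pow_le; lra |].
    assert (0 < / 3 / 4 ^ S m)
      by (apply Rdiv_lt_0_compat; [lra | apply pow_lt; lra]).
    lra. }
  rewrite S_INR in *.
  assert (1 <= INR m) by (apply (le_INR 1); assumption).
  pose proof ln_4_bounds; unfold Rsqr.
  set (c := ln 4) in *; set (p := INR m) in *; set (y := ln r) in *.
  split.
  - apply Rle_trans with (2 := Hlo).
    assert (y * y <= (4 * (p * c)) * (4 * (p * c)))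
      by (apply Rmult_le_compat; nra).
    assert (c * (p * p * c) <= 2 * (p * p * c)) by (apply Rmult_le_compat_r; nra).
    lra.
  - apply Rle_trans with (1 := Hup).
    assert ((2 * (p * c)) * (2 * (p * c)) <= y * y)
      by (apply Rmult_le_compat; nra).
    assert (9 / 8 * (p * p * c) <= c * (p * p * c)) by (apply Rmult_le_compat_r; nra).
    assert (1 * c <= p * p * c) by (apply Rmult_le_compat_r; nra).
    assert (p * c <= p * p * c) by nra.
    nra.
Qed.

(** * The entire function *)

Lemma is_series_norm_le {K : AbsRing} {V : NormedModule K}
    (b : nat -> V) (l : V) (B : nat -> R) (L : R) :
  (forall n, norm (b n) <= B n) -> is_series b l -> is_series B L ->
  norm l <= L.
Proof.
  intros Hle Hb HB.
  apply (is_lim_seq_le (fun n => norm (sum_n b n)) (sum_n B) (norm l) L).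
  - intros n; apply Rle_trans with (1 := norm_sum_n_m b 0 n).
    apply sum_n_m_le, Hle.
  - eapply filterlim_comp; [exact Hb | apply filterlim_norm].
  - exact HB.
Qed.

Lemma is_series_C_components (b : nat -> C) (l : C) :
  is_series (K := C_AbsRing) (V := C_NormedModule) b l ->
  l = (Series (fun n => fst (b n)), Series (fun n => snd (b n))).
Proof.
  intros Hb.
  assert (forall n, sum_n (fun k => fst (b k)) n = fst (sum_n b n)) as H1.
  { induction n as [| n IH]; [now rewrite !sum_O |].
    rewrite !sum_Sn, IH; reflexivity. }
  assert (forall n, sum_n (fun k => snd (b k)) n = snd (sum_n b n)) as H2.
  { induction n as [| n IH]; [now rewrite !sum_O |].
    rewrite !sum_Sn, IH; reflexivity. }
  rewrite (surjective_pairing l); f_equal; symmetry; apply is_series_unique.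
  - apply (filterlim_ext (fun n => fst (sum_n b n)));
      [intros n; symmetry; apply H1 |].
    eapply filterlim_comp; [exact Hb | apply continuous_fst].
  - apply (filterlim_ext (fun n => snd (sum_n b n)));
      [intros n; symmetry; apply H2 |].
    eapply filterlim_comp; [exact Hb | apply continuous_snd].
Qed.

Definition ctheta_term (z : C) (n : nat) : C := (theta_coef n * z ^ n)%C.

(** Summed by components, so that real [Series] give the value outright; [is_series_ctheta]
    identifies it with the complex sum. *)
Definition ctheta (z : C) : C :=
  (Series (fun n => fst (ctheta_term z n)),
   Series (fun n => snd (ctheta_term z n))).

Lemma is_series_theta (x : R) :
  is_series (fun n => theta_coef n * x ^ n) (theta x).
Proof. apply Series_correct, ex_series_theta. Qed.

Lemma Cmod_ctheta_term (z : C) (n : nat) :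
  Cmod (ctheta_term z n) = theta_coef n * Cmod z ^ n.
Proof.
  unfold ctheta_term; rewrite Cmod_mult, Cmod_R, Cmod_pow, Rabs_pos_eq;
    [reflexivity | apply Rlt_le, theta_coef_pos].
Qed.

Lemma is_series_ctheta (z : C) :
  is_series (K := C_AbsRing) (V := C_NormedModule) (ctheta_term z) (ctheta z).
Proof.
  destruct (ex_series_le (K := C_AbsRing) (V := C_CompleteNormedModule)
    (ctheta_term z) (fun n => theta_coef n * Cmod z ^ n)) as [l Hl].
  - intros n; apply Req_le, Cmod_ctheta_term.
  - apply ex_series_theta.
  - unfold ctheta; rewrite <- (is_series_C_components _ _ Hl); exact Hl.
Qed.

Lemma Cmod_ctheta_le (z : C) : Cmod (ctheta z) <= theta (Cmod z).
Proof.
  apply (is_series_norm_le (K := C_AbsRing) (V := C_NormedModule)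
    (ctheta_term z) _ (fun n => theta_coef n * Cmod z ^ n)).
  - intros n; apply Req_le, Cmod_ctheta_term.
  - apply is_series_ctheta.
  - apply is_series_theta.
Qed.

Lemma ctheta_real (x : R) : ctheta x = theta x.
Proof.
  assert (forall n, ctheta_term x n = RtoC (theta_coef n * x ^ n)) as H.
  { intros n; unfold ctheta_term; rewrite <- RtoC_pow, <- RtoC_mult; reflexivity. }
  unfold ctheta, RtoC; f_equal.
  - apply Series_ext; intros n; rewrite H; reflexivity.
  - rewrite (Series_ext _ (fun n => 0 * 0)), Series_scal_l; [ring |].
    intros n; rewrite H; simpl; ring.
Qed.

Lemma max_modulus_ctheta (r : R) : 0 <= r -> max_modulus ctheta r = theta r.
Proof.
  intros Hr; unfold max_modulus.
  rewrite (is_lub_Rbar_unique _ (theta r)); [reflexivity |].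
  split.
  - intros x [z [<- ->]]; apply Cmod_ctheta_le.
  - intros b Hb; apply Hb; exists r.
    pose proof (theta_ge_1 r Hr).
    rewrite ctheta_real, !Cmod_R, !Rabs_pos_eq by lra; split; reflexivity.
Qed.

(** Turns the factor n^2 of the Taylor remainder into a geometric one, so that the remainders sum to
    a multiple of theta(4 r). *)
Lemma pow_le_pow4 (n : nat) : INR n * INR n <= 4 ^ n.
Proof.
  rewrite <- mult_INR.
  replace 4 with (INR 4) by (simpl; ring).
  rewrite <- pow_INR; apply le_INR.
  induction n as [| n IH]; [simpl; lia |].
  rewrite Nat.pow_succ_r'; destruct n; [simpl; lia | nia].
Qed.

(** Second-order remainder of z^n, by induction: the remainder for n + 1 is (z + h) times the one
    for n, plus n z^(n-1) h^2. The factor n^2 r^n is crude but suffices against the coefficients of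
    the series. *)
Lemma Cmod_pow_taylor (z h : C) (r : R) (n : nat) :
  1 <= r -> Cmod z + Cmod h <= r ->
  Cmod ((z + h) ^ n - z ^ n - h * (INR n * z ^ pred n))%C
    <= INR n * INR n * r ^ n * (Cmod h * Cmod h).
Proof.
  intros Hr Hzh; pose proof (Cmod_ge_0 z) as Hz; pose proof (Cmod_ge_0 h) as Hh.
  induction n as [| n IH].
  - replace ((z + h) ^ 0 - z ^ 0 - h * (INR 0 * z ^ pred 0))%C with (RtoC 0)
      by (simpl; ring).
    rewrite Cmod_0; simpl; lra.
  (* At n = 0 the truncated [pred n] makes z * z^(pred n) equal to z instead of 1; the vanishing
     factor [INR n] repairs this. *)
  - assert (Hz1 : (INR n * (z * z ^ pred n) = INR n * z ^ n)%C).
    { destruct n; [simpl; ring | reflexivity]. }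
    replace ((z + h) ^ S n - z ^ S n - h * (INR (S n) * z ^ pred (S n)))%C
      with ((z + h) * ((z + h) ^ n - z ^ n - h * (INR n * z ^ pred n))
            + INR n * z ^ pred n * (h * h))%C.
    2:{ rewrite S_INR, RtoC_plus; simpl pred.
        change ((z + h) ^ S n)%C with ((z + h) * (z + h) ^ n)%C.
        change (z ^ S n)%C with (z * z ^ n)%C.
        replace (h * ((INR n + 1) * z ^ n))%C
          with (h * z ^ n + h * (INR n * z ^ n))%C by ring.
        rewrite <- Hz1; ring. }
    apply Rle_trans with (1 := Cmod_triangle _ _).
    rewrite (Cmod_mult (z + h)), !(Cmod_mult (INR n * _)), Cmod_mult.
    rewrite Cmod_mult, Cmod_R, Cmod_pow, (Rabs_pos_eq (INR n)) by apply pos_INR.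
    assert (Cmod z ^ pred n <= r ^ n).
    { apply Rle_trans with (r ^ pred n);
        [apply pow_incr; lra | apply Rle_pow; [lra | lia]]. }
    assert (0 < r ^ n) by (apply pow_lt; lra).
    assert (Cmod (z + h) <= r) by (apply Rle_trans with (1 := Cmod_triangle _ _); lra).
    pose proof (pos_INR n).
    apply Rle_trans with
      (r * (INR n * INR n * r ^ n * (Cmod h * Cmod h))
       + INR n * r ^ n * (Cmod h * Cmod h)).
    + apply Rplus_le_compat.
      * apply Rmult_le_compat; auto using Cmod_ge_0.
      * apply Rmult_le_compat_r; [nra |].
        apply Rmult_le_compat_l; lra.
    + rewrite S_INR; change (r ^ S n) with (r * r ^ n).
      assert (0 <= r ^ n * (Cmod h * Cmod h)) by (apply Rmult_le_pos; nra).
      set (w := r ^ n * (Cmod h * Cmod h)) in *.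
      replace (r * (INR n * INR n * r ^ n * (Cmod h * Cmod h)))
        with (r * (INR n * INR n) * w) by (unfold w; ring).
      replace (INR n * r ^ n * (Cmod h * Cmod h)) with (INR n * w) by (unfold w; ring).
      replace ((INR n + 1) * (INR n + 1) * (r * r ^ n) * (Cmod h * Cmod h))
        with (r * (INR n * INR n) * w + r * (2 * INR n + 1) * w) by (unfold w; ring).
      assert (INR n * w <= r * (2 * INR n + 1) * w) by (apply Rmult_le_compat_r; nra).
      lra.
Qed.

Definition ctheta_deriv_term (z : C) (n : nat) : C :=
  (theta_coef n * (INR n * z ^ pred n))%C.

(** Termwise differentiation: with r = |z| + 1 and |h| < 1, the summed Taylor remainders are at most
    |h|^2 theta(4 r), which is o(|h|). *)
Lemma ctheta_entire : entire ctheta.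
Proof.
  intros z; pose proof (Cmod_ge_0 z) as Hz.
  set (r := Cmod z + 1).
  assert (forall n, theta_coef n * (4 * r) ^ n = theta_coef n * (4 ^ n * r ^ n)) as Hpow
    by (intros n; rewrite Rpow_mult_distr; reflexivity).
  destruct (ex_series_le (K := C_AbsRing) (V := C_CompleteNormedModule)
    (ctheta_deriv_term z) (fun n => theta_coef n * (4 * r) ^ n)) as [l Hl].
  - intros n; change (Cmod (ctheta_deriv_term z n) <= theta_coef n * (4 * r) ^ n).
    unfold ctheta_deriv_term; rewrite !Cmod_mult, !Cmod_R, Cmod_pow, Hpow.
    rewrite !Rabs_pos_eq by (try apply pos_INR; apply Rlt_le, theta_coef_pos).
    apply Rmult_le_compat_l; [apply Rlt_le, theta_coef_pos |].
    apply Rmult_le_compat; [apply pos_INR | apply pow_le; lra | |].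
    + apply Rle_trans with (2 := pow_le_pow4 n).
      destruct n; [simpl; lra |].
      assert (1 <= INR (S n)) by (rewrite S_INR; pose proof (pos_INR n); lra); nra.
    + apply Rle_trans with (r ^ pred n); unfold r;
        [apply pow_incr; lra | apply Rle_pow; [lra | lia]].
  - apply ex_series_theta.
  - exists l; split; [apply is_linear_scal_l |].
    intros x Hx; apply (is_filter_lim_locally_unique
      (V := AbsRing_NormedModule C_AbsRing)) in Hx; subst x.
    intros eps.
    pose proof (theta_ge_1 (4 * r) ltac:(unfold r; lra)) as HK.
    assert (0 < Rmin 1 (eps / theta (4 * r))) as Hd.
    (* The bound 1 keeps |z| + |h| <= r; the other one makes |h| theta(4 r) smaller than eps. *)
    { apply Rmin_pos; [lra |]; apply Rdiv_lt_0_compat; [apply eps | lra]. }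
    exists (mkposreal _ Hd); intros y Hy.
    change (Cmod (y - z)%C < Rmin 1 (eps / theta (4 * r))) in Hy.
    change (Cmod (ctheta y - ctheta z - (y - z) * l)%C <= eps * Cmod (y - z)%C).
    set (h := (y - z)%C) in *.
    assert (Cmod h < 1 /\ Cmod h < eps / theta (4 * r)) as [Hh1 Hh2]
      by (split; apply Rlt_le_trans with (1 := Hy); [apply Rmin_l | apply Rmin_r]).
    pose proof (Cmod_ge_0 h) as Hh.
    apply Rle_trans with (Cmod h * Cmod h * theta (4 * r)).
    + apply (is_series_norm_le (K := C_AbsRing) (V := C_NormedModule)
        (fun n => plus (plus (ctheta_term y n) (opp (ctheta_term z n)))
           (opp (scal h (ctheta_deriv_term z n))))
        (plus (plus (ctheta y) (opp (ctheta z))) (opp (scal h l)))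
        (fun n => scal (Cmod h * Cmod h) (theta_coef n * (4 * r) ^ n))).
      * intros n.
        change (Cmod (ctheta_term y n - ctheta_term z n - h * ctheta_deriv_term z n)%C
          <= Cmod h * Cmod h * (theta_coef n * (4 * r) ^ n)).
        replace y with (z + h)%C by (unfold h; ring).
        unfold ctheta_term, ctheta_deriv_term.
        replace (theta_coef n * (z + h) ^ n - theta_coef n * z ^ n
                 - h * (theta_coef n * (INR n * z ^ pred n)))%C
          with (theta_coef n
                * ((z + h) ^ n - z ^ n - h * (INR n * z ^ pred n)))%C by ring.
        rewrite Cmod_mult, Cmod_R, (Rabs_pos_eq (theta_coef n)), Hpow
          by apply Rlt_le, theta_coef_pos.
        rewrite <- Rmult_assoc, (Rmult_comm _ (theta_coef n)), Rmult_assoc.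
        apply Rmult_le_compat_l; [apply Rlt_le, theta_coef_pos |].
        apply Rle_trans with (1 := Cmod_pow_taylor z h r n
          ltac:(unfold r; lra) ltac:(unfold r; lra)).
        rewrite (Rmult_comm (Cmod h * Cmod h)).
        apply Rmult_le_compat_r; [nra |].
        apply Rmult_le_compat_r; [apply pow_le; unfold r; lra | apply pow_le_pow4].
      * apply (is_series_plus (V := C_NormedModule)).
        -- apply (is_series_plus (V := C_NormedModule)); [apply is_series_ctheta |].
           apply (is_series_opp (V := C_NormedModule)), is_series_ctheta.
        -- apply (is_series_opp (V := C_NormedModule)).
           apply (is_series_scal (V := C_NormedModule)); exact Hl.
      * apply (is_series_scal (V := R_NormedModule)), is_series_theta.
    + apply Rlt_div_r in Hh2; [nra | lra].
Qed.

(** * Transcendence *)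

Lemma polynomial_growth (f : C -> C) :
  is_polynomial f ->
  exists (n : nat) (A : R), 0 <= A /\
    forall x : R, 1 <= x -> Cmod (f x) <= A * x ^ n.
Proof.
  intros [n [a Hf]]; exists n.
  cut (exists A, 0 <= A /\ forall x : R, 1 <= x ->
    Cmod (sum_n (fun k => (a k * x ^ k)%C) n) <= A * x ^ n).
  { intros [A [HA H]]; exists A; split; [exact HA |].
    intros x; rewrite Hf; apply H. }
  clear f Hf; induction n as [| n [A [HA IH]]].
  - exists (Cmod (a 0%nat)); split; [apply Cmod_ge_0 |].
    intros x _; rewrite sum_O, Cmod_mult; simpl; rewrite Cmod_1; lra.
  - exists (A + Cmod (a (S n))); pose proof (Cmod_ge_0 (a (S n))).
    split; [lra |].
    intros x Hx; rewrite sum_Sn.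
    apply Rle_trans with (1 := Cmod_triangle _ _).
    rewrite Cmod_mult, Cmod_pow, Cmod_R, (Rabs_pos_eq x) by lra.
    rewrite Rmult_plus_distr_r; apply Rplus_le_compat_r.
    apply Rle_trans with (1 := IH x Hx).
    apply Rmult_le_compat_l; [exact HA | apply Rle_pow; [lra | lia]].
Qed.

Lemma ctheta_transcendental : transcendental_entire ctheta.
Proof.
  split; [apply ctheta_entire |].
  intros Hp; destruct (polynomial_growth _ Hp) as [n [A [HA H]]].
  pose proof (pos_INR n) as Hn.
  (* At r = e^y the lower bound for log theta(r) is y^2 / 32 = (n + A + 1) y, which exceeds the
     polynomial bound A + n y because y >= 32. *)
  set (y := 32 * (INR n + A + 1)).
  pose proof (exp_ineq1_le y) as Hy.
  assert (16 <= exp y) as H16 by (unfold y in *; lra).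
  specialize (H (exp y) ltac:(lra)).
  pose proof (theta_ge_1 (exp y) ltac:(lra)) as H1.
  rewrite ctheta_real, Cmod_R, Rabs_pos_eq in H by lra.
  assert (ln (theta (exp y)) <= ln ((A + 1) * exp y ^ n)) as Hln.
  { apply ln_le; [lra |].
    apply Rle_trans with (1 := H), Rmult_le_compat_r; [| lra].
    apply pow_le; lra. }
  rewrite ln_mult, ln_pow, ln_exp in Hln by (try apply pow_lt; lra).
  pose proof (proj1 (ln_theta_bounds _ H16)) as Hlow; rewrite ln_exp in Hlow.
  assert (ln (A + 1) <= A) as HlnA.
  { rewrite <- (ln_exp A) at 2; apply ln_le; [lra |].
    pose proof (exp_ineq1_le A); lra. }
  unfold Rsqr, y in *; nra.
Qed.

(** * Iteration *)

Lemma iter_rel {A B : Type} (P : A -> B -> Prop) (g : A -> A) (h : B -> B) (a : A) (b : B) :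
  P a b -> (forall x y, P x y -> P (g x) (h y)) ->
  forall n, P (Nat.iter n g a) (Nat.iter n h b).
Proof. intros H0 HS n; induction n as [| n IH]; [exact H0 | apply HS, IH]. Qed.

(** A bounded increasing orbit would converge, by continuity, to a fixed point of g in [a, oo). This
    shows that the iterates from any admissible starting value pass every threshold. *)
Lemma iter_unbounded (g : R -> R) (a : R) :
  (forall x, a <= x -> continuous g x) -> (forall x, a <= x -> x < g x) ->
  forall B, exists n, B <= Nat.iter n g a.
Proof.
  intros Hc Hg B; apply NNPP; intros Hnot.
  assert (forall n, Nat.iter n g a <= B) as HB.
  { intros n; apply Rnot_lt_le; intros Hlt; apply Hnot; exists n; lra. }
  assert (forall n, a <= Nat.iter n g a) as Ha.
  { induction n as [| n IH]; [apply Rle_refl |].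
    simpl; apply Rlt_le, Rle_lt_trans with (1 := IH), Hg, IH. }
  assert (forall n, Nat.iter n g a <= Nat.iter (S n) g a) as Hincr
    by (intros n; apply Rlt_le, Hg, Ha).
  destruct (ex_finite_lim_seq_incr _ B Hincr HB) as [l Hl].
  assert (a <= l) as Hal by (apply (is_lim_seq_incr_compare _ _ Hl Hincr 0)).
  assert (is_lim_seq (fun n => Nat.iter (S n) g a) (g l)) as Hgl.
  { apply (filterlim_comp _ _ _ (fun n => Nat.iter n g a) g _ (locally l));
      [exact Hl | apply Hc, Hal]. }
  apply is_lim_seq_incr_1, is_lim_seq_unique in Hl.
  apply is_lim_seq_unique in Hgl; rewrite Hl in Hgl.
  injection Hgl as Heq; specialize (Hg l Hal); lra.
Qed.

Lemma iter_continuity (g : R -> R) (n : nat) :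
  continuity g -> continuity (Nat.iter n g).
Proof.
  intros Hg; induction n as [| n IH].
  - apply derivable_continuous, derivable_id.
  - apply (continuity_comp (Nat.iter n g) g IH Hg).
Qed.

(* Compactness: points following the itinerary for ever longer finite times
   accumulate at one that follows it for all times. *)
Lemma orbit_in_intervals (g : R -> R) (lo hi : nat -> R) :
  continuity g ->
  (forall n, lo n <= hi n) ->
  (forall n y, lo (S n) <= y <= hi (S n) -> exists x, lo n <= x <= hi n /\ g x = y) ->
  exists x, forall n, lo n <= Nat.iter n g x <= hi n.
Proof.
  intros Hg Hne Hcov.
  assert (forall n k, exists x, forall j, (j <= n)%nat ->
    lo (k + j)%nat <= Nat.iter j g x <= hi (k + j)%nat) as Hfin.
  { induction n as [| n IH]; intros k.
    - exists (lo k); intros j Hj; replace j with 0%nat by lia.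
      rewrite Nat.add_0_r; split; [apply Rle_refl | apply Hne].
    - destruct (IH (S k)) as [y Hy].
      destruct (Hcov k y) as [x [Hx Hxy]].
      { specialize (Hy 0%nat ltac:(lia)); rewrite Nat.add_0_r in Hy; exact Hy. }
      exists x; intros [| j] Hj; [rewrite Nat.add_0_r; exact Hx |].
      rewrite Nat.iter_succ_r, Hxy, Nat.add_succ_r.
      apply (Hy j); lia. }
  set (u := fun n => proj1_sig (constructive_indefinite_description _ (Hfin n 0%nat))).
  assert (forall n j, (j <= n)%nat -> lo j <= Nat.iter j g (u n) <= hi j) as Hu.
  { intros n; apply (proj2_sig (constructive_indefinite_description _ (Hfin n 0%nat))). }
  destruct (Bolzano_Weierstrass u _ (compact_P3 (lo 0%nat) (hi 0%nat))) as [x Hx].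
  { intros n; apply (Hu n 0%nat); lia. }
  exists x; intros n.
  assert (forall eps, 0 < eps ->
    exists p, lo n <= p <= hi n /\ Rabs (p - Nat.iter n g x) < eps) as Hclose.
  { intros eps Heps.
    destruct (iter_continuity g n Hg x eps Heps) as [d [Hd Hcont]].
    destruct (Hx (disc x (mkposreal d Hd)) n) as [p [Hp Hdp]].
    { exists (mkposreal d Hd); intros y Hy; exact Hy. }
    exists (Nat.iter n g (u p)); split; [apply Hu, Hp |].
    (* [continuity] only speaks of points different from x, so the case u p = x is separate. *)
    destruct (Req_dec x (u p)) as [<- | Hneq].
    - rewrite Rminus_diag, Rabs_R0; exact Heps.
    - apply Hcont; split; [split; [exact I | exact Hneq] | exact Hdp]. }
  split; apply Rnot_lt_le; intros Hlt.
  - destruct (Hclose (lo n - Nat.iter n g x) ltac:(lra)) as [p [Hp Hd]].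
    apply Rabs_def2 in Hd; lra.
  - destruct (Hclose (Nat.iter n g x - hi n) ltac:(lra)) as [p [Hp Hd]].
    apply Rabs_def2 in Hd; lra.
Qed.

(** * Logarithmic comparisons and log-regularity *)

Lemma rpow_pos (x y : R) : 0 < x -> rpow x y = Rpower x y.
Proof. intros Hx; unfold rpow; destruct (Rlt_dec 0 x); [reflexivity | contradiction]. Qed.

Lemma ln_rpow (x y : R) : 0 < x -> ln (rpow x y) = y * ln x.
Proof. intros Hx; rewrite rpow_pos by exact Hx; apply ln_exp. Qed.

Lemma rpow_gt_0 (x y : R) : 0 < x -> 0 < rpow x y.
Proof. intros Hx; rewrite rpow_pos by exact Hx; apply exp_pos. Qed.

Lemma ln_le_inv (x y : R) : 0 < x -> 0 < y -> ln x <= ln y -> x <= y.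
Proof.
  intros Hx Hy H; apply Rnot_lt_le; intros Hlt.
  apply ln_increasing in Hlt; lra.
Qed.

Lemma ln_theta_nonneg (r : R) : 0 <= r -> 0 <= ln (theta r).
Proof.
  intros Hr; rewrite <- ln_1; apply ln_le; [lra | apply theta_ge_1, Hr].
Qed.

Lemma ln_exp_ge (a r : R) : exp a <= r -> a <= ln r.
Proof.
  intros H; rewrite <- (ln_exp a); apply ln_le; [apply exp_pos | exact H].
Qed.

Lemma ge_16_of_exp (a r : R) : 16 <= a -> exp a <= r -> 16 <= r.
Proof. intros Ha Hr; pose proof (exp_ineq1_le a); lra. Qed.

Lemma theta_gt_id (r : R) : exp 64 <= r -> r < theta r.
Proof.
  intros Hr; pose proof (ln_exp_ge _ _ Hr) as Hy.
  pose proof (ge_16_of_exp 64 r ltac:(lra) Hr) as H16.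
  pose proof (theta_ge_1 r ltac:(lra)).
  apply ln_lt_inv; [lra | lra |].
  apply Rlt_le_trans with (2 := proj1 (ln_theta_bounds r H16)).
  unfold Rsqr; nra.
Qed.

(** With k = 64 and d = 2: log M(r^64) >= 64^2 (log r)^2 / 32 = 128 (log r)^2 >= k d log M(r). *)
Lemma ctheta_log_regular : log_regular ctheta.
Proof.
  exists 16, 64, 2; repeat split; try lra.
  intros r Hr.
  assert (ln (rpow r 64) = 64 * ln r) as Hln by (apply ln_rpow; lra).
  assert (0 < ln r) as Hpos by (rewrite <- ln_1; apply ln_increasing; lra).
  assert (r < rpow r 64) as Hrr.
  { apply ln_lt_inv; [lra | apply rpow_gt_0; lra | lra]. }
  rewrite !max_modulus_ctheta by lra.
  pose proof (theta_ge_1 r ltac:(lra)).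
  pose proof (theta_ge_1 (rpow r 64) ltac:(lra)).
  apply Rle_ge; apply Rnot_lt_le; intros Hlt.
  apply ln_increasing in Hlt; [| lra].
  rewrite (ln_rpow (theta r)) in Hlt by lra.
  pose proof (proj1 (ln_theta_bounds (rpow r 64) ltac:(lra))) as H1.
  pose proof (proj2 (ln_theta_bounds r ltac:(lra))) as H2.
  rewrite Hln in H1; unfold Rsqr in *; lra.
Qed.

(** * Equality of Q(f) and A(f) *)

Lemma mu_ctheta (eps r : R) : 0 <= r -> mu ctheta eps r = exp (eps * ln (theta r)).
Proof.
  intros Hr; unfold mu; rewrite max_modulus_ctheta, rpow_pos by
    (try exact Hr; pose proof (theta_ge_1 r Hr); lra); reflexivity.
Qed.

Lemma max_modulus_ctheta_unbounded (R1 : R) :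
  0 < R1 -> (forall r, R1 <= r -> max_modulus ctheta r > r) ->
  forall B, exists n, B <= Nat.iter n (max_modulus ctheta) R1.
Proof.
  intros HR1 Hgt; apply iter_unbounded; [| exact Hgt].
  intros x Hx; apply (continuous_ext_loc _ theta).
  (* [max_modulus ctheta] is known to agree with [theta] only on nonnegative reals; the ball of
     radius x about x stays there. *)
  - exists (mkposreal x ltac:(lra)); intros y Hy.
    symmetry; apply max_modulus_ctheta.
    apply Rabs_def2 in Hy; unfold minus, plus, opp in Hy; simpl in Hy; lra.
  - apply continuity_pt_filterlim, theta_continuity.
Qed.

Lemma mu_ctheta_unbounded (eps R1 : R) :
  0 < R1 -> (forall r, R1 <= r -> mu ctheta eps r > r) ->
  forall B, exists n, B <= Nat.iter n (mu ctheta eps) R1.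
Proof.
  intros HR1 Hgt; apply iter_unbounded; [| exact Hgt].
  intros x Hx; apply (continuous_ext_loc _ (fun r => exp (eps * ln (theta r)))).
  - exists (mkposreal x ltac:(lra)); intros y Hy.
    symmetry; apply mu_ctheta.
    apply Rabs_def2 in Hy; unfold minus, plus, opp in Hy; simpl in Hy; lra.
  - apply (continuous_comp (fun r => eps * ln (theta r)) exp); [| apply continuous_exp].
    apply (continuous_scal_r eps (fun r => ln (theta r))).
    apply (continuous_comp theta ln);
      [apply continuity_pt_filterlim, theta_continuity | apply continuous_ln].
    pose proof (theta_ge_1 x ltac:(lra)); lra.
Qed.

(** The N steps that the iterates of g need to get ahead of b are absorbed into the shift [l]. Hence
    rates with different starting values can be compared. *)
Lemma escapes_shift (f : C -> C) (g h : R -> R) (a b : R) (z : C) (N : nat) :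
  escapes_at_rate f g a z ->
  (forall n, Nat.iter n h b <= Nat.iter n g (Nat.iter N g a)) ->
  escapes_at_rate f h b z.
Proof.
  intros [l Hl] Hle; exists (N + l)%nat; intros n.
  specialize (Hl (n + N)%nat); specialize (Hle n).
  rewrite (Nat.iter_add n N) in Hl; rewrite Nat.add_assoc; lra.
Qed.

Lemma fast_escaping_quite_fast (z : C) :
  fast_escaping ctheta z -> quite_fast_escaping ctheta z.
Proof.
  intros [R1 [HR1 [Hgt Hesc]]].
  destruct (max_modulus_ctheta_unbounded R1 HR1 Hgt (exp 128)) as [N HN].
  (* For eps = 1/2, log mu(r) >= (log r)^2 / 64, which exceeds log r once log r >= 128. *)
  exists (/ 2), (exp 128); split; [lra | split; [apply exp_pos | split]].
  - intros r Hr; pose proof (ln_exp_ge _ _ Hr) as Hy.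
    pose proof (ge_16_of_exp 128 r ltac:(lra) Hr) as H16.
    rewrite mu_ctheta by lra.
    rewrite <- (exp_ln r) at 2 by lra; apply exp_increasing.
    pose proof (proj1 (ln_theta_bounds r H16)) as Hlo.
    unfold Rsqr in Hlo; nra.
  - apply (escapes_shift _ _ _ _ _ _ N Hesc).
    intros n; apply (iter_rel (fun x y => 0 <= x <= y)).
    + split; [apply Rlt_le, exp_pos | exact HN].
    + intros x y Hxy.
      rewrite mu_ctheta, max_modulus_ctheta by lra.
      pose proof (theta_ge_1 y ltac:(lra)).
      pose proof (ln_theta_nonneg x ltac:(lra)) as H0.
      split; [apply Rlt_le, exp_pos |].
      apply Rle_trans with (2 := theta_incr x y Hxy).
      pose proof (theta_ge_1 x ltac:(lra)).
      apply ln_le_inv; [apply exp_pos | lra | rewrite ln_exp; lra].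
Qed.

(* With [K = 32 / eps] one has eps (K t)^2 / 32 = K t^2, so the relation
   [K * ln x <= ln y] is preserved when [M] acts on [x] and [mu] on [y]. *)
Lemma quite_fast_escaping_fast (z : C) :
  quite_fast_escaping ctheta z -> fast_escaping ctheta z.
Proof.
  intros [eps [R1 [Heps [HR1 [Hgt Hesc]]]]].
  set (K := 32 / eps).
  assert (32 <= K) as HK.
  { apply (Rle_div_r 32 32 eps); lra. }
  destruct (mu_ctheta_unbounded eps R1 HR1 Hgt (exp (K * 64))) as [N HN].
  exists (exp 64); split; [apply exp_pos | split].
  - intros r Hr; rewrite max_modulus_ctheta; [apply theta_gt_id, Hr |].
    apply Rle_trans with (2 := Hr), Rlt_le, exp_pos.
  - apply (escapes_shift _ _ _ _ _ _ N Hesc).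
    intros n.
    assert (forall x y, exp 64 <= x /\ K * ln x <= ln y -> exp 64 <= x /\ 64 <= ln x /\
      ln x <= ln y /\ 0 < x <= y) as Haux.
    { intros x y [Hx Hxy]; pose proof (ln_exp_ge _ _ Hx).
      assert (ln x <= ln y) by nra.
      assert (0 < x) by (apply Rlt_le_trans with (2 := Hx), exp_pos).
      repeat split; try assumption.
      apply Rnot_lt_le; intros Hlt.
      destruct (Rlt_dec 0 y) as [Hy | Hy].
      - apply ln_increasing in Hlt; lra.
      (* [ln] takes the value 0 at nonpositive arguments, contradicting 64 <= ln x <= ln y. *)
      - assert (ln y = 0); [| lra].
        unfold ln; destruct (Rlt_dec 0 y); [contradiction | reflexivity]. }
    apply (Haux _ (Nat.iter n (mu ctheta eps) (Nat.iter N (mu ctheta eps) R1))).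
    apply (iter_rel (fun x y => exp 64 <= x /\ K * ln x <= ln y)).
    + split; [apply Rle_refl |].
      rewrite ln_exp; apply ln_exp_ge, HN.
    + intros x y Hxy; destruct (Haux x y Hxy) as [Hx [H64 [Hln Hle]]].
      destruct Hxy as [_ Hxy].
      pose proof (ge_16_of_exp 64 x ltac:(lra) Hx) as H16.
      rewrite mu_ctheta, max_modulus_ctheta by lra.
      split.
      * pose proof (theta_gt_id x Hx); lra.
      * rewrite ln_exp.
        pose proof (proj1 (ln_theta_bounds y ltac:(lra))) as H1.
        pose proof (proj2 (ln_theta_bounds x H16)) as H2.
        unfold Rsqr in *.
        assert ((K * ln x) * (K * ln x) <= ln y * ln y)
          by (apply Rmult_le_compat; nra).
        apply Rle_trans with (eps * ((K * ln x) * (K * ln x) / 32));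
          [| apply Rmult_le_compat_l; lra].
        replace (eps * (K * ln x * (K * ln x) / 32)) with (K * (ln x * ln x))
          by (unfold K; field; lra).
        apply Rmult_le_compat_l; lra.
Qed.

(** * A slow orbit *)

Lemma ln_theta_large (r : R) : exp 1024 <= r -> 24 <= ln (theta r).
Proof.
  intros Hr; pose proof (ln_exp_ge _ _ Hr) as Hy.
  pose proof (ln_theta_bounds r (ge_16_of_exp 1024 r ltac:(lra) Hr)) as [H _].
  unfold Rsqr in H; nra.
Qed.

Lemma ln_mu2_ctheta (r : R) :
  exp 1024 <= r -> ln (mu2 ctheta (3 / 4) r) = Rpower (ln (theta r)) (3 / 4).
Proof.
  intros Hr; pose proof (ln_theta_large r Hr).
  pose proof (ge_16_of_exp 1024 r ltac:(lra) Hr).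
  unfold mu2; rewrite ln_exp, max_modulus_ctheta, rpow_pos by lra; reflexivity.
Qed.

(** After two logarithms, with L = log log r, the claim follows from L < 3/4 (2 L - log 32), that is
    L > 3/2 log 32. The threshold 1024 = 32^2 gives L >= 2 log 32. *)
Lemma mu2_ctheta_gt_id (r : R) : exp 1024 <= r -> r < mu2 ctheta (3 / 4) r.
Proof.
  intros Hr; pose proof (ln_theta_large r Hr) as HL.
  pose proof (ge_16_of_exp 1024 r ltac:(lra) Hr) as H16.
  pose proof (ln_exp_ge _ _ Hr) as Hy.
  apply ln_lt_inv; [lra | apply exp_pos |].
  rewrite ln_mu2_ctheta by exact Hr.
  apply ln_lt_inv; [lra | apply exp_pos |].
  rewrite ln_Rpower.
  assert (ln (ln r * ln r) <= ln (32 * ln (theta r))) as H.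
  { apply ln_le; [nra |].
    pose proof (proj1 (ln_theta_bounds r H16)) as H; unfold Rsqr in H; lra. }
  rewrite !ln_mult in H by lra.
  assert (2 * ln 32 <= ln (ln r)).
  { replace (2 * ln 32) with (ln 1024); [apply ln_le; lra |].
    replace 1024 with (32 ^ 2) by ring; rewrite ln_pow; simpl; lra. }
  assert (0 < ln 32) by (rewrite <- ln_1; apply ln_increasing; lra).
  lra.
Qed.

Lemma ln_mu2_ctheta_le (r : R) :
  exp 1024 <= r -> ln (mu2 ctheta (3 / 4) r) <= Rpower (ln r) (3 / 2).
Proof.
  intros Hr; pose proof (ln_theta_large r Hr) as HL.
  pose proof (ge_16_of_exp 1024 r ltac:(lra) Hr) as H16.
  pose proof (ln_exp_ge _ _ Hr) as Hy.
  rewrite ln_mu2_ctheta by exact Hr.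
  replace (3 / 2) with (3 / 4 + 3 / 4) by field.
  rewrite Rpower_plus, Rpower_mult_distr by lra.
  apply Rle_Rpower_l; [lra |].
  pose proof (ln_theta_bounds r H16); unfold Rsqr in *; lra.
Qed.

(** The factor 1280 = 5 * 256 places the next interval [-256 s, -s], s = mu2(r), inside
    [-theta(r) / 5, 0]. With t = log theta(r) >= 24, both log 1280 <= 12 and t^(3/4) are at most t /
    2, the latter because t >= 16. *)
Lemma mu2_ctheta_le_theta (r : R) :
  exp 1024 <= r -> 1280 * mu2 ctheta (3 / 4) r <= theta r.
Proof.
  intros Hr; pose proof (ln_theta_large r Hr) as HL.
  pose proof (ge_16_of_exp 1024 r ltac:(lra) Hr) as H16.
  pose proof (theta_ge_1 r ltac:(lra)) as H1.
  assert (0 < mu2 ctheta (3 / 4) r) as Hpos by apply exp_pos.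
  apply ln_le_inv; [lra | lra |].
  rewrite ln_mult, ln_mu2_ctheta by (exact Hr || lra).
  assert (ln 1280 <= 12).
  { apply Rle_trans with (ln (4 ^ 6)); [apply ln_le; lra |].
    rewrite ln_pow by lra; pose proof ln_4_bounds; simpl; lra. }
  assert (Rpower (ln (theta r)) (3 / 4) <= ln (theta r) / 2); [| lra].
  apply ln_le_inv; [apply exp_pos | lra |].
  rewrite ln_Rpower, ln_div by lra.
  assert (4 * ln 2 <= ln (ln (theta r))); [| lra].
  replace (4 * ln 2) with (ln 16); [apply ln_le; lra |].
  replace 16 with (2 ^ 4) by ring; rewrite ln_pow; simpl; lra.
Qed.

(** If 16^m <= r < 16^(m+1), then -16^(m+1) and -16^(m+2) both lie in [-256 r, -r]. There theta has
    opposite signs and modulus at least theta(r) / 5, so the intermediate value theorem applies. *)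
Lemma theta_cover (r y : R) :
  16 <= r -> - (theta r / 5) <= y <= 0 ->
  exists x, - (256 * r) <= x <= - r /\ theta x = y.
Proof.
  intros Hr Hy; destruct (pow16_bracket r Hr) as [m [_ [Hl Hu]]].
  pose proof (theta_neg_large (S m)) as H1.
  pose proof (theta_neg_large (S (S m))) as H2.
  assert (theta r <= theta (16 ^ S m)) by (apply theta_incr; lra).
  change (16 ^ S (S m)) with (16 * 16 ^ S m) in *.
  assert (theta r <= theta (16 * 16 ^ S m)) by (apply theta_incr; lra).
  pose proof (theta_ge_1 r ltac:(lra)).
  change ((-1) ^ S (S m)) with (-1 * (-1) ^ S m) in H2.
  change (16 ^ S m) with (16 * 16 ^ m) in *.
  destruct (IVT_gen theta (- (16 * (16 * 16 ^ m))) (- (16 * 16 ^ m)) y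
    theta_continuity) as [x [Hx Hxy]].
  - assert ((-1) ^ S m = 1 \/ (-1) ^ S m = -1) as [Hs | Hs].
    { generalize (S m); intros k; induction k as [| k IH]; simpl; lra. }
    + rewrite Hs in *; rewrite Rmin_left, Rmax_right by lra; lra.
    + rewrite Hs in *; rewrite Rmin_right, Rmax_left by lra; lra.
  - exists x; rewrite Rmin_left, Rmax_right in Hx by lra; lra.
Qed.

Definition slow_rate (n : nat) : R := Nat.iter n (mu2 ctheta (3 / 4)) (exp 1024).

Lemma slow_rate_ge (n : nat) : exp 1024 <= slow_rate n.
Proof.
  induction n as [| n IH]; [apply Rle_refl |].
  apply Rlt_le, Rle_lt_trans with (1 := IH), (mu2_ctheta_gt_id _ IH).
Qed.

Lemma ln_slow_rate_le (n : nat) : ln (slow_rate n) <= Rpower 1024 ((3 / 2) ^ n).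
Proof.
  induction n as [| n IH].
  - change (ln (exp 1024) <= Rpower 1024 1).
    rewrite ln_exp, Rpower_1; lra.
  - apply Rle_trans with (1 := ln_mu2_ctheta_le _ (slow_rate_ge n)).
    change ((3 / 2) ^ S n) with (3 / 2 * (3 / 2) ^ n).
    rewrite (Rmult_comm (3 / 2)), <- Rpower_mult.
    apply Rle_Rpower_l; [lra |].
    pose proof (ln_exp_ge _ _ (slow_rate_ge n)).
    split; [unfold slow_rate in *; lra | exact IH].
Qed.

(** The factor 32 reproduces itself: log x >= 32 a gives log theta(x) >= (32 a)^2 / 32 = 32 a^2, so
    a is squared at each step. *)
Lemma ln_iter_theta_ge (n : nat) :
  exp (32 * 1024) <= Nat.iter n theta (exp (32 * 1024)) /\
  32 * Rpower 1024 (2 ^ n) <= ln (Nat.iter n theta (exp (32 * 1024))).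
Proof.
  induction n as [| n [IH1 IH2]].
  - change (Nat.iter 0 theta (exp (32 * 1024))) with (exp (32 * 1024)).
    rewrite ln_exp, pow_O, Rpower_1; lra.
  - simpl Nat.iter; set (x := Nat.iter n theta (exp (32 * 1024))) in *.
    pose proof (ge_16_of_exp (32 * 1024) x ltac:(lra) IH1) as H16.
    split.
    + apply Rle_trans with (1 := IH1), Rlt_le, theta_gt_id.
      apply Rle_trans with (2 := IH1), Rlt_le, exp_increasing; lra.
    + apply Rle_trans with (2 := proj1 (ln_theta_bounds x H16)).
      replace (2 ^ S n) with (2 ^ n + 2 ^ n) by (simpl; ring).
      rewrite Rpower_plus; unfold Rsqr.
      assert (0 < Rpower 1024 (2 ^ n)) by apply exp_pos.
      nra.
Qed.

Lemma iter_ctheta_real (x : R) (n : nat) :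
  Nat.iter n ctheta (RtoC x) = RtoC (Nat.iter n theta x).
Proof.
  induction n as [| n IH]; [reflexivity |].
  simpl; rewrite IH; apply ctheta_real.
Qed.

Lemma slow_orbit_exists :
  exists x : R, forall n : nat,
    slow_rate n <= Cmod (Nat.iter n ctheta (RtoC x)) <= 256 * slow_rate n.
Proof.
  destruct (orbit_in_intervals theta (fun n => - (256 * slow_rate n))
    (fun n => - slow_rate n)) as [x Hx].
  - apply theta_continuity.
  - intros n; pose proof (ge_16_of_exp 1024 _ ltac:(lra) (slow_rate_ge n)); lra.
  - intros n y Hy.
    pose proof (slow_rate_ge n) as Hn.
    pose proof (ge_16_of_exp 1024 _ ltac:(lra) Hn) as H16.
    pose proof (ge_16_of_exp 1024 _ ltac:(lra) (slow_rate_ge (S n))).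
    apply theta_cover; [exact H16 |].
    pose proof (mu2_ctheta_le_theta _ Hn).
    change (mu2 ctheta (3 / 4) (slow_rate n)) with (slow_rate (S n)) in *; lra.
  - exists x; intros n; specialize (Hx n).
    pose proof (ge_16_of_exp 1024 _ ltac:(lra) (slow_rate_ge n)).
    rewrite iter_ctheta_real, Cmod_R, Rabs_left1; lra.
Qed.

Lemma slow_orbit_quite_fast2 (x : C) :
  (forall n, slow_rate n <= Cmod (Nat.iter n ctheta x)) ->
  quite_fast_escaping2 ctheta x.
Proof.
  intros Hx; exists (3 / 4), (exp 1024).
  split; [lra | split; [apply exp_pos | split]].
  - intros r Hr; pose proof (ge_16_of_exp 1024 r ltac:(lra) Hr).
    split; [| apply mu2_ctheta_gt_id, Hr].
    rewrite max_modulus_ctheta by lra; apply theta_ge_1; lra.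
  - exists 0%nat; intros n; rewrite Nat.add_0_r; apply Rle_ge, Hx.
Qed.

(* On the logarithmic scale the orbit grows like [1024^((3/2)^n)], whereas the
   iterates of [M] grow at least like [1024^(2^n)]. *)
Lemma slow_orbit_not_fast (x : C) :
  (forall n, Cmod (Nat.iter n ctheta x) <= 256 * slow_rate n) ->
  ~ fast_escaping ctheta x.
Proof.
  intros Hx [R1 [HR1 [Hgt Hesc]]].
  destruct (max_modulus_ctheta_unbounded R1 HR1 Hgt (exp (32 * 1024))) as [N HN].
  destruct Hesc as [l Hl].
  (* Since 2 = (3/2) (4/3), a large n lets 2^n overtake (3/2)^(n + N + l) despite the fixed delay N
     + l. *)
  destruct (Pow_x_infinity (4 / 3) ltac:(rewrite Rabs_pos_eq; lra)
    ((3 / 2) ^ (N + l))) as [n Hn].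
  specialize (Hn n (Nat.le_refl n)).
  rewrite Rabs_pos_eq in Hn by (apply pow_le; lra).
  assert ((3 / 2) ^ (n + N + l) <= 2 ^ n) as Hexp.
  { rewrite <- Nat.add_assoc, pow_add.
    replace (2 ^ n) with ((3 / 2) ^ n * (4 / 3) ^ n)
      by (rewrite <- Rpow_mult_distr; f_equal; field).
    apply Rmult_le_compat_l; [apply pow_le |]; lra. }
  specialize (Hl (n + N)%nat); specialize (Hx (n + N + l)%nat).
  rewrite (Nat.iter_add n N) in Hl.
  assert (Nat.iter n theta (exp (32 * 1024))
    <= Nat.iter n (max_modulus ctheta) (Nat.iter N (max_modulus ctheta) R1)) as Hit.
  { apply (iter_rel (fun x y => 0 <= x <= y)).
    - split; [apply Rlt_le, exp_pos | exact HN].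
    - intros a b Hab; rewrite max_modulus_ctheta by lra.
      pose proof (theta_ge_1 a ltac:(lra)).
      split; [lra | apply theta_incr, Hab]. }
  destruct (ln_iter_theta_ge n) as [Hpos Hlow].
  pose proof (exp_pos (32 * 1024)) as Hexp0.
  assert (ln (Nat.iter n theta (exp (32 * 1024))) <= ln (256 * slow_rate (n + N + l)))
    as Hln by (apply ln_le; lra).
  pose proof (slow_rate_ge (n + N + l)) as Hsl.
  rewrite ln_mult in Hln by (pose proof (exp_pos 1024); lra).
  pose proof (ln_slow_rate_le (n + N + l)) as Hup.
  pose proof (Rle_Rpower 1024 _ _ ltac:(lra) Hexp) as HR.
  assert (ln 256 <= 8).
  { replace 256 with (4 ^ 4) by ring; rewrite ln_pow by lra.
    pose proof ln_4_bounds; simpl; lra. }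
  (* With X = 1024^(2^n) the estimates combine to 32 X <= 8 + X, which is impossible for X >=
     1024. *)
  assert (1024 <= Rpower 1024 (2 ^ n)).
  { rewrite <- (Rpower_1 1024) at 1 by lra.
    apply Rle_Rpower; [lra | apply pow_R1_Rle; lra]. }
  lra.
Qed.

Theorem mainTheorem6 :
  exists f : C -> C,
    transcendental_entire f /\
    log_regular f /\
    ~ same_set (quite_fast_escaping2 f) (fast_escaping f) /\
    same_set (quite_fast_escaping f) (fast_escaping f) /\
    ~ same_set (quite_fast_escaping2 f) (quite_fast_escaping f).
Proof.
  destruct slow_orbit_exists as [x Hx].
  assert (quite_fast_escaping2 ctheta x) as HQ2
    by (apply slow_orbit_quite_fast2; intros n; apply Hx).
  assert (~ fast_escaping ctheta x) as HA
    by (apply slow_orbit_not_fast; intros n; apply Hx).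
  exists ctheta; split; [apply ctheta_transcendental |].
  split; [apply ctheta_log_regular |].
  split; [intros H; apply HA, H, HQ2 |].
  split.
  - intros z; split; [apply quite_fast_escaping_fast | apply fast_escaping_quite_fast].
  - intros H; apply HA, quite_fast_escaping_fast, H, HQ2.
Qed.
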